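(* Let $\mathcal{G}$ and $\mathcal{G}^{\mathcal{W}}$ be switching equivalent signed graphs with adjacency matrices $A$ and $A^{\mathcal{W}}$ and with switching matrix $\Theta$. Then $\mathbf{x}(t)$ is a solution of the opinion dynamics on $\mathcal{G}$, $$\dot{\mathbf{x}}=-d\,\mathbf{x}+U\,S(\alpha\mathbf{x}+\gamma A\mathbf{x}),$$ if and only if $\Theta\mathbf{x}(t)$ is a solution of the opinion dynamics on $\mathcal{G}^{\mathcal{W}}$, $$\dot{\mathbf{x}}=-d\,\mathbf{x}+U\,S(\alpha\mathbf{x}+\gamma A^{\mathcal{W}}\mathbf{x}).$$
   Context: A signed graph $\mathcal{G}=(\mathcal{V},\mathcal{E},\sigma)$ has vertex set $\mathcal{V}=\{1,\dots,N\}$, directed edge set $\mathcal{E}$ ($e_{ik}$ points from $i$ to $k$), and signature $\sigma:\mathcal{E}\to\{1,-1\}$; the underlying directed graph is simple (no self-loops, at most one edge from $i$ to $k$). The signed adjacency matrix $A=(a_{ik})$ has $a_{ik}=\sigma(e_{ik})$ if $e_{ik}\in\mathcal{E}$ and $a_{ik}=0$ otherwise. For $\mathcal{W}\subset\mathcal{V}$, the switching function is $\theta:\mathcal{V}\to\{1,-1\}$ with $\theta(i)=-1$ if $i\in\mathcal{W}$ and $\theta(i)=1$ otherwise. Switching $\mathcal{W}$ on $\mathcal{G}$ produces $\mathcal{G}^{\mathcal{W}}=(\mathcal{V},\mathcal{E},\sigma_{\mathcal{W}})$ with $\sigma_{\mathcal{W}}(e_{ik})=\theta(i)\sigma(e_{ik})\theta(k)$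 for all $e_{ik}\in\mathcal{E}$. Then $\mathcal{G}$ and $\mathcal{G}^{\mathcal{W}}$ are called switching equivalent. The switching matrix is $\Theta=\operatorname{diag}(\theta(1),\dots,\theta(N))$, and $A^{\mathcal{W}}=\Theta^{-1}A\Theta$ with $\Theta^{-1}=\Theta$. In the dynamics, $\mathbf{x}\in\mathbb{R}^N$, $d>0$, $\alpha\ge0$, $\gamma>0$, $U=\operatorname{diag}(u_1,\dots,u_N)$ with $u_i>0$; $S(\mathbf{y}):=(S(y_1),\dots,S(y_N))$ where $S:\mathbb{R}\to\mathbb{R}$ is a smooth, odd, saturating (bounded) function with $S(0)=0$, $S'(0)=1$, $\operatorname{sign}(S''(x))=-\operatorname{sign}(x)$. *)

(* Defs.v *)
From HB Require Import structures.
From mathcomp Require Import all_boot all_order all_algebra.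
From mathcomp Require Import all_classical all_reals all_analysis.

Set Implicit Arguments.
Unset Strict Implicit.
Unset Printing Implicit Defensive.

Import Order.TTheory GRing.Theory Num.Theory.
Import numFieldNormedType.Exports.

Local Open Scope classical_set_scope.
Local Open Scope ring_scope.

(* Vertices are 'I_N; the pair (i, k) is the edge e_ik from i to k.  Edges
   form a set of ordered pairs, so there is at most one edge from i to k,
   while e_ik and e_ki may both be present. *)
Record signedGraph (N : nat) := SignedGraph {
  edges : {set 'I_N * 'I_N};
  signature : {e : 'I_N * 'I_N | e \in edges} -> int;
  edges_irrefl : forall i : 'I_N, (i, i) \notin edges;
  signature_pm1 : forall e, signature e = 1 \/ signature e = -1
}.

Definition adjacency (R : realType) (N : nat) (G : signedGraph N) : 'M[R]_N :=
  \matrix_(i, k)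
    if insub (i, k) is Some e then (@signature N G e)%:~R else 0.

Definition switching_fun (N : nat) (W : {set 'I_N}) (i : 'I_N) : int :=
  if i \in W then -1 else 1.

Definition switch_signature (N : nat) (G : signedGraph N) (W : {set 'I_N})
    (e : {e : 'I_N * 'I_N | e \in edges G}) : int :=
  switching_fun W (val e).1 * signature e * switching_fun W (val e).2.

Lemma switch_signature_pm1 (N : nat) (G : signedGraph N) (W : {set 'I_N}) e :
  @switch_signature N G W e = 1 \/ @switch_signature N G W e = -1.
Proof.
rewrite /switch_signature /switching_fun.
by case: (signature_pm1 e) => ->; do 2!case: ifP => _; [left|right|right|left
  |right|left|left|right].
Qed.

Definition switch (N : nat) (G : signedGraph N) (W : {set 'I_N}) :
    signedGraph N :=
  SignedGraph (@edges_irrefl N G) (@switch_signature_pm1 N G W).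

Definition switching_matrix (R : realType) (N : nat) (W : {set 'I_N}) :
    'M[R]_N :=
  diag_mx (\row_i (switching_fun W i)%:~R).

Record saturating_sigmoid (R : realType) (S : R -> R) : Prop := {
  sigmoid_smooth : forall (n : nat) (y : R), derivable (S^`(n)%classic) y 1;
  sigmoid_odd : forall y : R, S (- y) = - S y;
  sigmoid_bounded : [bounded S y | y in setT];
  sigmoid0 : S 0 = 0;
  sigmoid_slope0 : S^`()%classic 0 = 1;
  sigmoid_curvature : forall y : R, Num.sg (S^`(2)%classic y) = - Num.sg y
}.

Definition opinion_field (R : realType) (N : nat) (d alpha gamma : R)
    (u : 'rV[R]_N) (S : R -> R) (A : 'M[R]_N) (x : 'cV[R]_N) : 'cV[R]_N :=
  - d *: x + diag_mx u *m map_mx S (alpha *: x + gamma *: (A *m x)).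

(* x solves x' = f(x) on the interval J.  The difference quotient is taken
   along increments that stay in J, so the derivative is one-sided at an
   endpoint belonging to J, and the values of x outside J are irrelevant. *)
Definition solution_on (R : realType) (N : nat) (J : interval R)
    (f : 'cV[R]_N -> 'cV[R]_N) (x : R -> 'cV[R]_N) : Prop :=
  forall t : R, t \in J ->
    h^-1 *: (x (h + t) - x t)
      @[h --> within [set h | h + t \in J] 0^'] --> f (x t).

(* For an open interval this is the usual two-sided derivative. *)
Lemma solution_on_open (R : realType) (N : nat) (J : interval R)
    (f : 'cV[R]_N -> 'cV[R]_N) (x : R -> 'cV[R]_N) :
  open [set` J] ->
  solution_on J f x <-> forall t : R, t \in J -> is_derive t 1 x (f (x t)).
Proof.
move=> oJ.
have E t : t \in J -> within [set h | h + t \in J] 0^' = 0^' :> set_system R.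
  move=> tJ; apply/seteqP; split=> P; rewrite /within /= => PP.
    have n0 : \forall h \near 0^', h + t \in J.
      apply: nbhs_dnbhs.
      have : nbhs (0 + t) [set` J].
        by rewrite add0r; apply: open_nbhs_nbhs.
      suff : h + t @[h --> (0 : R)] --> 0 + t by apply.
      by apply: cvgD; [exact: cvg_id|exact: cvg_cst].
    by near=> h; apply: (near PP h) => //; near: h.
  by near=> h => _; near: h.
have Eq t : (fun h : R => h^-1 *: (x (h *: 1 + t) - x t)) =
            (fun h : R => h^-1 *: (x (h + t) - x t)).
  by apply/funext => h; rewrite [h *: 1]mulr1.
split=> H t tJ.
  have := H t tJ; rewrite (E t tJ) => Ht.
  split; first by apply/cvg_ex; exists (f (x t)); rewrite /= Eq.
  by rewrite /derive Eq; apply/cvg_lim.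
have [dx <-] := H t tJ; rewrite (E t tJ).
by move: dx; rewrite /derivable /derive Eq.
Unshelve. all: by end_near. Qed.

(* Main.v *)
Require Import Defs.
From mathcomp Require Import all_boot all_order all_algebra.
From mathcomp Require Import all_classical all_reals all_analysis.

Import Order.TTheory GRing.Theory Num.Theory.
Import numFieldNormedType.Exports.

Local Open Scope classical_set_scope.
Local Open Scope ring_scope.

(** The opinion dynamics is equivariant under the switching matrix [Theta].
    Two facts make this so: the signed adjacency matrix of the switched graph
    is [Theta A Theta] (lemma [adjacency_switch]), and an odd nonlinearity
    applied entrywise commutes with a diagonal matrix of signs (lemma
    [map_mx_switching]).  Since [Theta] is an involution and commutes with the
    diagonal matrix [U], the vector field of the switched graph at [Theta x]
    is therefore [Theta] times the original field at [x] (lemma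
    [opinion_field_switch]).  A constant linear map
    commutes with the limit of difference quotients, so [Theta] carries
    solutions to solutions (lemma [solution_on_mulmx]); the converse is the
    same statement for [Theta^-1 = Theta]. *)

Lemma switching_fun_pm1 (N : nat) (W : {set 'I_N}) (i : 'I_N) :
  switching_fun W i = 1 \/ switching_fun W i = -1.
Proof. by rewrite /switching_fun; case: ifP => _; [right|left]. Qed.

Lemma switching_matrixK (R : realType) (N : nat) (W : {set 'I_N}) :
  switching_matrix R W *m switching_matrix R W = 1%:M.
Proof.
rewrite /switching_matrix mulmx_diag -diag_const_mx; congr diag_mx.
apply/rowP => i; rewrite !mxE.
by case: (switching_fun_pm1 N W i) => ->; rewrite -intrM.
Qed.

(** Both sides are tested on the same edge set, so non-edges give [0 = 0]. *)
Lemma adjacency_switch (R : realType) (N : nat) (G : signedGraph N)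
    (W : {set 'I_N}) :
  adjacency R (switch G W) =
  switching_matrix R W *m adjacency R G *m switching_matrix R W.
Proof.
apply/matrixP => i k.
rewrite /switching_matrix mul_mx_diag mul_diag_mx !mxE /=.
case: insubP => [e _ ve|_]; last by rewrite mulr0 mul0r.
by rewrite /= /switch_signature ve /= !intrM.
Qed.

Lemma map_mx_switching (R : realType) (N : nat) (W : {set 'I_N}) (S : R -> R)
    (S_odd : forall y : R, S (- y) = - S y) (v : 'cV[R]_N) :
  map_mx S (switching_matrix R W *m v) = switching_matrix R W *m map_mx S v.
Proof.
apply/matrixP => i j; rewrite /switching_matrix !mul_diag_mx !mxE.
by case: (switching_fun_pm1 N W i) => ->; rewrite ?mul1r // !mulN1r S_odd.
Qed.

Lemma opinion_field_switch (R : realType) (N : nat) (G : signedGraph N)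
    (W : {set 'I_N}) (d alpha gamma : R) (u : 'rV[R]_N) (S : R -> R)
    (S_odd : forall y : R, S (- y) = - S y) (x : 'cV[R]_N) :
  opinion_field d alpha gamma u S (adjacency R (switch G W))
    (switching_matrix R W *m x) =
  switching_matrix R W *m
    opinion_field d alpha gamma u S (adjacency R G) x.
Proof.
rewrite /opinion_field adjacency_switch.
rewrite -[_ *m (switching_matrix R W *m x)]mulmxA.
rewrite [switching_matrix R W *m (_ *m x)]mulmxA switching_matrixK mul1mx.
rewrite -mulmxA !scalemxAr -!mulmxDr map_mx_switching//.
by rewrite mulmxDr 2!mulmxA [diag_mx u *m _]diag_mxC.
Qed.

Lemma mulmx_continuous (R : realType) (m n p : nat) (M : 'M[R]_(m, n)) :
  continuous (mulmx M : 'M[R]_(n, p) -> 'M[R]_(m, p)).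
Proof.
have entry_continuous i j :
    continuous (fun y : 'M[R]_(n, p) => (M *m y) i j).
  under eq_fun do rewrite mxE.
  apply: continuous_big => [|k _]; first exact: add_continuous.
  by move=> x; exact: cvgMl_tmp (@coord_continuous R n p k j x).
(* A neighborhood of [M *m x] contains a box of entrywise neighborhoods,
   so continuity of each of the finitely many entries suffices. *)
move=> x A [P nbhsP PA].
suff : \forall y \near x, forall i j, P i j ((M *m y) i j).
  by apply: filterS => y Py; exact: PA.
apply: (@filter_forall _ _ _ _ (nbhs_filter x)) => i.
apply: (@filter_forall _ _ _ _ (nbhs_filter x)) => j.
exact: entry_continuous (nbhsP i j).
Qed.

Lemma solution_on_mulmx (R : realType) (N : nat) (J : interval R)
    (M : 'M[R]_N) (f g : 'cV[R]_N -> 'cV[R]_N) (x : R -> 'cV[R]_N) :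
  (forall y, g (M *m y) = M *m f y) ->
  solution_on J f x -> solution_on J g (fun t => M *m x t).
Proof.
move=> gM xf t tJ; rewrite gM.
under eq_fun do rewrite -mulmxBr scalemxAr.
by apply: cvg_comp (xf t tJ) _; exact: mulmx_continuous.
Qed.

Theorem mainTheorem4 (R : realType) (N : nat) (G : signedGraph N)
    (W : {set 'I_N}) (d alpha gamma : R) (u : 'rV[R]_N) (S : R -> R)
    (d_gt0 : 0 < d) (alpha_ge0 : 0 <= alpha) (gamma_gt0 : 0 < gamma)
    (u_gt0 : forall i : 'I_N, 0 < u 0 i) (S_sigmoid : saturating_sigmoid S)
    (J : interval R) (J_nondegenerate : [set` J]° !=set0)
    (x : R -> 'cV[R]_N) :
  solution_on J (opinion_field d alpha gamma u S (adjacency R G)) x <->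
  solution_on J
    (opinion_field d alpha gamma u S (adjacency R (switch G W)))
    (fun t => switching_matrix R W *m x t).
Proof.
have ThetaK y : switching_matrix R W *m (switching_matrix R W *m y) = y.
  by rewrite mulmxA switching_matrixK mul1mx.
have field_switch y := opinion_field_switch R N G W d alpha gamma u S
  (sigmoid_odd S_sigmoid) y.
split=> [|Theta_x]; first exact: solution_on_mulmx.
have -> : x = fun t => switching_matrix R W *m (switching_matrix R W *m x t).
  by apply/funext => t; rewrite ThetaK.
apply: solution_on_mulmx Theta_x => y.
by rewrite -{2}[y]ThetaK field_switch ThetaK.
Qed.
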